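(* Let $g:\mathbb{R}^K\to\mathbb{R}$ be convex and twice differentiable with $L$-Lipschitz gradient, and let $(x^{(r)})_{r\ge0}$ be generated by the cyclic coordinate gradient descent (CGD) method with inverse stepsizes $P_k\ge L_{\max}$ for all $k$ (and $P_k>0$), applied to $\min_{x\in\mathbb{R}^K}g(x)$. Then $$\|H(\xi)\|^2\le\min\Big\{KL^2,\ \Big(\sum_{k=1}^KL_k\Big)^2\Big\}\qquad\text{for all }\xi_2,\dots,\xi_K\in\mathbb{R}^K,$$ and thus, for every optimal solution $x^*$, $$g(x^{(r)})-g(x^* )\le 2\left(P_{\max}+\frac{\min\{KL^2,(\sum_kL_k)^2\}}{P_{\min}}\right)\frac{R_0^2}{r},\qquad\forall\, r\ge1.$$
   Context: Write $H_{ij}(x)=\frac{\partial^2g}{\partial x_i\partial x_j}(x)$. Assume $|H_{ij}(x)|\le L_{ij}$ for all $x$ and all $i,j$, and set $L_i=L_{ii}$ (the Lipschitz constant of $\nabla_i g$ with respect to coordinate $x_i$), with $L_{ij}\le\sqrt{L_i}\sqrt{L_j}$. $L_{\max}=\max_kL_k$, $P_{\max}=\max_kP_k$, $P_{\min}=\min_kP_k$. For $\xi=(\xi_2,\dots,\xi_K)$ with $\xi_k\in\mathbb{R}^K$, $H(\xi)$ is the strictly lower triangular $K\times K$ matrix whose $(k,j)$ entry is $H_{kj}(\xi_k)$ if $j<k$ and $0$ if $j\ge k$ (so each row is evaluated at its own point). $\|H(\xi)\|$ is the spectral norm; vector norms are Euclidean. Cyclic CGD: from $x^{(0)}\in\mathbb{R}^K$,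 given $x^{(r)}$ set $w_1^{(r)}=x^{(r)}$, and for $k=1,\dots,K$ set $w_{k+1}^{(r)}=w_k^{(r)}-\frac1{P_k}\nabla_kg(w_k^{(r)})e_k$, where $e_k$ is the $k$-th unit vector; then $x^{(r+1)}=w_{K+1}^{(r)}$. $X^*$ is the set of minimizers of $g$, assumed nonempty, and $R_0=\max_{x\in\mathbb{R}^K}\max_{x^*\in X^*}\{\|x-x^*\| : g(x)\le g(x^{(0)})\}$, assumed finite. *)

(* Defs.v *)
From mathcomp Require Export all_boot all_order all_algebra.
From mathcomp Require Export all_classical all_reals all_analysis.
Export Order.TTheory GRing.Theory Num.Theory numFieldNormedType.Exports.

Set Implicit Arguments.
Unset Strict Implicit.
Unset Printing Implicit Defensive.

Local Open Scope classical_set_scope.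
Local Open Scope ring_scope.

(* The dimension K >= 1 is written n.+1, points of R^K are row vectors, and the
   coordinates 1, ..., K become 0, ..., n. *)

Section Defs.
Context {R : realType} {n : nat}.
Implicit Types (g : 'rV[R]_n.+1 -> R) (x u v w : 'rV[R]_n.+1).

(* The library norm on 'rV[R]_n is the sup norm, hence this definition. *)
Definition enorm v : R := Num.sqrt (\sum_i v ord0 i ^+ 2).

(* v *m A^T is the row-vector form of the column vector A v. *)
Definition spectral_norm (A : 'M[R]_n.+1) : R :=
  sup [set enorm (v *m A^T) | v in [set v | enorm v = 1]].

Definition unit_vec (k : 'I_n.+1) : 'rV[R]_n.+1 := delta_mx ord0 k.

Definition partial g (k : 'I_n.+1) x : R := 'D_(unit_vec k) g x.

Definition grad g x : 'rV[R]_n.+1 := \row_k partial g k x.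

(* Differentiability of [grad g] is Frechet differentiability of a map
   R^K -> R^K; it does not depend on the choice of norm. *)
Definition twice_differentiable g : Prop :=
  (forall x, differentiable g x) /\ (forall x, differentiable (grad g) x).

Definition hess g (i j : 'I_n.+1) x : R := partial (partial g j) i x.

Definition lipschitz_grad g (L : R) : Prop :=
  forall x y, enorm (grad g x - grad g y) <= L * enorm (x - y).

(* The first row is zero, so [xi ord0] is unused: only the points
   xi_2, ..., xi_K of the 1-based numbering matter. *)
Definition lower_hess g (xi : 'I_n.+1 -> 'rV[R]_n.+1) : 'M[R]_n.+1 :=
  \matrix_(k, j) if (j < k)%N then hess g k j (xi k) else 0.

Definition cgd_step g (P : 'I_n.+1 -> R) w (k : 'I_n.+1) : 'rV[R]_n.+1 :=
  w - ((P k)^-1 * partial g k w) *: unit_vec k.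

(* [enum 'I_n.+1] lists the coordinates in increasing order. *)
Definition cgd_cycle g (P : 'I_n.+1 -> R) x : 'rV[R]_n.+1 :=
  foldl (cgd_step g P) x (enum 'I_n.+1).

Definition cgd g (P : 'I_n.+1 -> R) x0 (r : nat) : 'rV[R]_n.+1 :=
  iter r (cgd_cycle g P) x0.

Definition minimizers g : set 'rV[R]_n.+1 := [set u | forall y, g u <= g y].

Definition level_dists g x0 : set R :=
  [set d | exists x u, [/\ g x <= g x0, minimizers g u & d = enorm (x - u)]].

(* This supremum is a maximum whenever the maximum exists. *)
Definition radius0 g x0 : R := sup (level_dists g x0).

Definition maxc (f : 'I_n.+1 -> R) : R := \big[Num.max/f ord0]_k f k.
Definition minc (f : 'I_n.+1 -> R) : R := \big[Num.min/f ord0]_k f k.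

End Defs.

(* Main.v *)
From mathcomp Require Import ring lra.
Require Import Defs.

(* For the norm bound, ||H(xi)|| is at most the Frobenius norm. Row k is part of
   the derivative of grad g along e_k, so it has norm at most L; and its entries
   are at most sqrt(L_k L_j), whose squares sum to (sum_k L_k)^2.

   For the rate, let d_k be the k-th coordinate step of a cycle started at x and
   a_k = grad_k g(x) - grad_k g(w_k), so that grad_k g(x) = P_k d_k + a_k. The
   usual estimate, |P d + a|^2 <= 2 |P d|^2 + 2 |a|^2 against the decrease
   sum_k P_k d_k^2 / 2, loses a factor 2 with respect to the claimed constant.
   It is recovered as follows. If l bounds the diagonal of the Hessian, the
   decrease over a cycle is at least sum_k d_k^2 (P_k - l/2), and the strict
   triangularity of H gives |a|^2 <= m |d|^2 with l^2 + 2m <= M, where M is one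
   of the two quantities of the minimum:
   - M = K L^2: a_k involves no displacement along e_k, so cocoercivity of the
     gradient gives |a_k| <= (L/2) |d|, hence m = (K-1) L^2 / 4 and l <= L;
   - M = (sum_k L_k)^2: m = sum_(j < k) L_j L_k and l = L_max.
   Young's inequality with a well-chosen parameter then gives
   |grad g(x)|^2 <= 2 (P_max + M / P_min) (decrease of g over the cycle), and
   convexity turns this into D_r^2 <= s (D_r - D_{r+1}) for the gaps
   D_r = g(x^(r)) - g(x^star), with s = 2 (P_max + M / P_min) R_0^2. *)

Set Implicit Arguments.
Unset Strict Implicit.
Unset Printing Implicit Defensive.

Local Open Scope classical_set_scope.
Local Open Scope ring_scope.

(** * Scalar inequalities and the recursion for the gaps *)

(** Lagrange's identity: the double sum of squares below is twice the difference of the two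
    sides. *)
Lemma cauchy_schwarz_sum (R : realDomainType) (I : finType) (P : pred I)
    (u v : I -> R) :
  (\sum_(i | P i) u i * v i) ^+ 2 <=
  (\sum_(i | P i) u i ^+ 2) * (\sum_(i | P i) v i ^+ 2).
Proof.
have: 0 <= \sum_(i | P i) \sum_(j | P j) (u i * v j - u j * v i) ^+ 2.
  by apply: sumr_ge0 => i _; apply: sumr_ge0 => j _; exact: sqr_ge0.
suff -> : \sum_(i | P i) \sum_(j | P j) (u i * v j - u j * v i) ^+ 2 =
    \sum_(i | P i) \sum_(j | P j) u i ^+ 2 * v j ^+ 2
    + \sum_(i | P i) \sum_(j | P j) v i ^+ 2 * u j ^+ 2
    - 2 * \sum_(i | P i) \sum_(j | P j) (u i * v i) * (u j * v j).
  rewrite -!big_distrlr /= -expr2.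
  by lra.
rewrite mulr_sumr -big_split -sumrB; apply: eq_bigr => i _.
by rewrite mulr_sumr -big_split -sumrB; apply: eq_bigr => j _ /=; ring.
Qed.

(* In (a + b)^2 <= (1 + t) a^2 + (1 + 1/t) b^2 take a = P_k d_k and b = a_k; the
   left-hand side below is the coefficient of d_k^2 that results from summing. The choice t = (1 + l/q)/2 is
   exact in the extremal case l = p = q = Q, m = q^2. *)
Lemma young_constant (R : realFieldType) (l q Q m M : R) :
  0 < q -> 0 <= l -> l <= q -> 0 <= m -> l ^+ 2 + 2 * m <= M ->
  exists2 t : R, 0 < t &
    forall p, q <= p -> p <= Q ->
      (1 + t) * p ^+ 2 + (1 + t^-1) * m <= (Q + M / q) * (2 * p - l).
Proof.
move=> q0 l0 lq m0 Mlm; exists ((q + l) / (2 * q)).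
  by apply: divr_gt0; lra.
move=> p qp pQ.
(* The [p ^+ 2] part and the coefficient of [m] are bounded separately; each difference is rewritten
   so that its sign is visible from [0 <= l <= q <= p]. *)
have p2 : (1 + (q + l) / (2 * q)) * p ^+ 2 <= (p + l ^+ 2 / q) * (2 * p - l).
  rewrite -subr_ge0.
  have -> : (p + l ^+ 2 / q) * (2 * p - l) - (1 + (q + l) / (2 * q)) * p ^+ 2 =
      ((q - l) * ((q - l) ^+ 2 + l ^+ 2)
       + (p - q) * (2 * (q - l) ^+ 2 + 2 * l ^+ 2) + (p - q) ^+ 2 * (q - l))
      / (2 * q) by field; lra.
  have ? := sqr_ge0 (q - l); have ? := sqr_ge0 l; have ? := sqr_ge0 (p - q).
  by apply: divr_ge0; [apply: addr_ge0; first apply: addr_ge0;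
    apply: mulr_ge0|]; lra.
have m2 : 1 + ((q + l) / (2 * q))^-1 <= 2 / q * (2 * p - l).
  rewrite -subr_ge0.
  have -> : 2 / q * (2 * p - l) - (1 + ((q + l) / (2 * q))^-1) =
      ((q - l) * (q + 2 * l) + 4 * (p - q) * (q + l)) / (q * (q + l)).
    by field; rewrite ?mulf_neq0//; lra.
  apply: divr_ge0; last by apply: mulr_ge0; lra.
  by apply: addr_ge0; apply: mulr_ge0; lra.
have /(ler_wpM2r m0) m2m := m2.
have MQ : p + l ^+ 2 / q + 2 / q * m <= Q + M / q.
  have : (l ^+ 2 + 2 * m) / q <= M / q by rewrite ler_pM2r ?invr_gt0.
  by rewrite mulrDl; lra.
have /(ler_wpM2r _) := MQ => /(_ (2 * p - l)); lra.
Qed.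

Lemma sqr_recursion_bound (R : realFieldType) (D : nat -> R) (s : R) :
  0 <= s -> (forall r, 0 <= D r) ->
  (forall r, D r ^+ 2 <= s * (D r - D r.+1)) ->
  forall r, r%:R * D r <= s.
Proof.
rewrite le_eqVlt => /predU1P[<-|s0] D0 Drec r.
  move: (Drec r); rewrite mul0r => D2.
  have /eqP : D r ^+ 2 = 0 by apply/eqP; rewrite eq_le D2 sqr_ge0.
  by rewrite sqrf_eq0 => /eqP ->; rewrite mulr0.
elim: r => [|r IH]; first by rewrite mul0r ltW.
move: IH (Drec r) (D0 r) (D0 r.+1) (ler0n R r); rewrite -natr1.
move: (D r) (D r.+1) (r%:R : R) => x y k kx xy x0 y0 k0.
(* Otherwise [x ^+ 2 > s * x >= s * (x - y)], against the recursion. *)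
have xs : x <= s by rewrite leNgt; apply/negP => sx; nra.
rewrite -(ler_pM2l s0).
(* Expanded: [(k + 1) * s * x - k * x ^+ 2 <= s ^+ 2]. Adding the recursion [k + 1] times bounds
   [s * ((k + 1) * y)] by [s ^+ 2]. *)
have : 0 <= (s - x) * (s - k * x) by apply: mulr_ge0; lra.
have : 0 <= k * (s * (x - y) - x ^+ 2) by apply: mulr_ge0; lra.
nra.
Qed.

(** * Calculus along a line *)

Section Directional.
Context {R : realType} {V : normedModType R}.
Implicit Types (f : V -> R) (x u : V).

Lemma is_derive_line f x u (t : R) : differentiable f (x + t *: u) ->
  is_derive t 1 (fun s : R => f (x + s *: u)) ('D_u f (x + t *: u)).
Proof.
move=> /diff_derivable df; have := df u.
rewrite /derivable /derive => cu.
have E : (fun h : R => h^-1 *: (((fun s : R => f (x + s *: u)) \o shift t) (h *: 1)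
    - f (x + t *: u))) =
    (fun h : R => h^-1 *: ((f \o shift (x + t *: u)) (h *: u) - f (x + t *: u))).
  apply/funext => h /=; congr (_ *: (f _ - _)).
  by rewrite [h *: 1]mulr1 scalerDl addrCA.
by split; rewrite /derivable /derive E.
Qed.

(** The mean value theorem replaces integration: [psi], the function on the segment minus its
    quadratic model, has nonpositive derivative for [t >= 0]. *)
Lemma descent_line f x u (c : R) : (forall y, differentiable f y) ->
  (forall t : R, 0 <= t -> 'D_u f (x + t *: u) - 'D_u f x <= c * t) ->
  f (x + u) <= f x + 'D_u f x + c / 2.
Proof.
move=> df Df.
pose psi (t : R) := f (x + t *: u) - ('D_u f x * t + c / 2 * t ^+ 2).
have dpsi (t : R) : is_derive t 1 psi ('D_u f (x + t *: u) - ('D_u f x + c * t)).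
  have dl := is_derive_line (df (x + t *: u)).
  have : is_derive t 1 ('D_u f x \*: id + (c / 2) \*: (id ^+ 2) : R -> R) ('D_u f x + c * t).
    apply: (is_derive_eq (is_deriveD (is_deriveZ ('D_u f x) (is_derive_id t 1))
      (is_deriveZ (c / 2) (is_deriveX 2 (is_derive_id t 1))))).
    by rewrite /GRing.scale /= ; field.
  move=> dq; exact: (is_deriveB dl dq).
have [|xi xi01 E] := @MVT R psi _ 0 1 ltr01 (fun t _ => dpsi t).
  by apply: derivable_within_continuous => t _; have [] := dpsi t.
move: E; rewrite /psi scale0r scale1r addr0.
have xi0 : 0 <= xi by move: xi01; rewrite in_itv /= => /andP[/ltW].
have := Df _ xi0; lra.
Qed.

Lemma mvt_line f x u (B : R) : (forall y, differentiable f y) ->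
  (forall y, `|'D_u f y| <= B) -> `|f (x + u) - f x| <= B.
Proof.
move=> df Df.
have dphi (t : R) := is_derive_line (df (x + t *: u)).
have [|xi xi01 E] := @MVT R _ _ 0 1 ltr01 (fun t _ => dphi t).
  by apply: derivable_within_continuous => t _; have [] := dphi t.
by move: E; rewrite scale1r scale0r addr0 subr0 mulr1 => ->.
Qed.

End Directional.

(** * One-sided difference quotients and the tangent inequality *)

Section Convex.
Context {R : realType} {V : normedModType R}.
Implicit Types (f : V -> R) (x u : V).

(** The limit of the difference quotients can be taken from the right, where each quotient is at
    most [B]. *)
Lemma derive_le f x u (B : R) : derivable f x u ->
  (forall h : R, 0 < h -> h <= 1 -> f (h *: u + x) - f x <= h * B) ->
  'D_u f x <= B.
Proof.
move=> cvf fB; rewrite /derive cvg_at_rightE //; apply: limr_le.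
  rewrite -(cvg_at_rightE (fun h : R => h^-1 *: ((f \o shift x) _ - f x))) //.
  apply: cvg_trans cvf; apply: cvg_app.
  by move=> A [e e0 Ae]; exists e => // z ze z0; apply: Ae => //; exact/lt0r_neq0.
near=> h.
have h0 : 0 < h by near: h; exact: nbhs_right_gt.
have h1 : h <= 1 by near: h; exact: nbhs_right_le.
by rewrite /GRing.scale /= ler_pdivrMl //; exact: fB.
Unshelve. all: by end_near. Qed.

Lemma convex_gradient_le f x y :
  convex_function [set: convex_lmodType V] f -> differentiable f x ->
  f x + 'D_(y - x) f x <= f y.
Proof.
move=> cf df; rewrite -lerBrDl.
apply: derive_le => [|h h0 h1]; first exact: diff_derivable.
have := cf (Itv01 (ltW h0) h1) y x; rewrite !inE => /(_ Logic.I Logic.I).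
rewrite convRE /= {1}/conv /= => cfh.
have -> : h *: (y - x) + x = h *: y + (1 - h) *: x.
  by rewrite scalerBr scalerBl scale1r addrA addrAC.
by move: cfh; rewrite /unstable.onem; lra.
Qed.

End Convex.

(** * Euclidean inner product and norm *)

Section Euclidean.
Context {R : realType} {n : nat}.
Implicit Types (u v w : 'rV[R]_n.+1).

Definition dot u v : R := \sum_k u ord0 k * v ord0 k.

Lemma dotC u v : dot u v = dot v u.
Proof. by apply: eq_bigr => k _; rewrite mulrC. Qed.

Lemma dotDl u v w : dot (u + v) w = dot u w + dot v w.
Proof. by rewrite -big_split; apply: eq_bigr => k _; rewrite mxE mulrDl. Qed.

Lemma dotZl (a : R) u v : dot (a *: u) v = a * dot u v.
Proof. by rewrite mulr_sumr; apply: eq_bigr => k _; rewrite mxE mulrA. Qed.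

Lemma dotNl u v : dot (- u) v = - dot u v.
Proof. by rewrite -scaleN1r dotZl mulN1r. Qed.

Lemma dotDr u v w : dot u (v + w) = dot u v + dot u w.
Proof. by rewrite dotC dotDl !(dotC u). Qed.

Lemma dotZr (a : R) u v : dot u (a *: v) = a * dot u v.
Proof. by rewrite dotC dotZl dotC. Qed.

Lemma dotNr u v : dot u (- v) = - dot u v.
Proof. by rewrite dotC dotNl dotC. Qed.

Lemma enorm_ge0 v : 0 <= enorm v.
Proof. exact: sqrtr_ge0. Qed.

Lemma enorm_sqr v : enorm v ^+ 2 = \sum_k v ord0 k ^+ 2.
Proof. by rewrite sqr_sqrtr// sumr_ge0// => k _; exact: sqr_ge0. Qed.

Lemma enorm_sqr_dot v : enorm v ^+ 2 = dot v v.
Proof. by rewrite enorm_sqr; apply: eq_bigr => k _; rewrite expr2. Qed.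

Lemma coord_sqr_le_enorm v k : v ord0 k ^+ 2 <= enorm v ^+ 2.
Proof.
rewrite enorm_sqr (bigD1 k)//= lerDl.
by apply: sumr_ge0 => i _; exact: sqr_ge0.
Qed.

Lemma enormZ (a : R) v : enorm (a *: v) = `|a| * enorm v.
Proof.
rewrite -sqrtr_sqr /enorm -sqrtrM ?sqr_ge0// mulr_sumr.
by congr Num.sqrt; apply: eq_bigr => k _; rewrite mxE exprMn.
Qed.

Lemma dot_le_enorm u v : dot u v <= enorm u * enorm v.
Proof.
apply: le_trans (ler_norm _) _.
rewrite -(@ler_pXn2r _ 2)// ?nnegrE ?mulr_ge0 ?enorm_ge0//.
by rewrite real_normK ?num_real// exprMn !enorm_sqr; exact: cauchy_schwarz_sum.
Qed.

Lemma enorm_unit_vec k : enorm (unit_vec k : 'rV[R]_n.+1) = 1.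
Proof.
rewrite /enorm (bigD1 k)//= big1 => [|j jk].
  by rewrite mxE !eqxx expr1n addr0 sqrtr1.
by rewrite mxE eqxx (negbTE jk) expr0n.
Qed.

End Euclidean.

(** * Coordinate estimates and cocoercivity of the gradient *)

Section Coordinates.
Context {R : realType} {n : nat}.
Implicit Types (g : 'rV[R]_n.+1 -> R) (x u : 'rV[R]_n.+1).

Lemma derive_dot g x u : differentiable g x -> 'D_u g x = dot (grad g x) u.
Proof.
move=> dg; rewrite deriveE// {1}(row_sum_delta u) linear_sum.
by apply: eq_bigr => k _; rewrite linearZ mxE /partial deriveE// mulrC.
Qed.

Lemma derive_unit_vec g x (h : R) k : differentiable g x ->
  'D_(h *: unit_vec k) g x = h * partial g k x.
Proof. by move=> dg; rewrite /partial !deriveE// linearZ. Qed.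

Lemma differentiable_partial g x k :
  differentiable (grad g) x -> differentiable (partial g k) x.
Proof.
move=> dg; have -> : partial g k = (fun N : 'rV[R]_n.+1 => N ord0 k) \o grad g.
  by apply/funext => y /=; rewrite mxE.
by apply: differentiable_comp => //; exact: differentiable_coord.
Qed.

Lemma partial_variation f x (h : R) k (B : R) : (forall y, differentiable f y) ->
  (forall y, `|partial f k y| <= B) ->
  `|f (x + h *: unit_vec k) - f x| <= `|h| * B.
Proof.
move=> df fB; apply: mvt_line => // y.
by rewrite derive_unit_vec// normrM ler_wpM2l.
Qed.

Lemma coordinate_descent g x (h : R) k (l : R) :
  (forall y, differentiable g y) -> (forall y, differentiable (partial g k) y) ->
  (forall y, `|hess g k k y| <= l) ->
  g (x + h *: unit_vec k) <= g x + h * partial g k x + l / 2 * h ^+ 2.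
Proof.
move=> dg dpg hl; rewrite -(derive_unit_vec _ _ (dg x)) [_ / 2 * _]mulrAC.
apply: descent_line => // t t0; rewrite !derive_unit_vec// -mulrBr scalerA.
apply: le_trans (ler_norm _) _; rewrite normrM.
have := partial_variation x (t * h) dpg hl.
rewrite normrM (ger0_norm t0) => /(ler_wpM2l (normr_ge0 h)) /le_trans; apply.
by rewrite -(@real_normK _ h) ?num_real// expr2; lra.
Qed.

Lemma lipschitz_grad_ge0 g (L : R) : lipschitz_grad g L -> 0 <= L.
Proof.
move=> /(_ (unit_vec ord0) 0); rewrite subr0 enorm_unit_vec mulr1.
exact/le_trans/enorm_ge0.
Qed.

Lemma lipschitz_grad_descent g (L : R) x u :
  (forall y, differentiable g y) -> lipschitz_grad g L ->
  g (x + u) <= g x + dot (grad g x) u + L / 2 * enorm u ^+ 2.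
Proof.
move=> dg gL; rewrite -derive_dot// [_ / 2 * _]mulrAC.
apply: descent_line => // t t0; rewrite !derive_dot// -dotNl -dotDl.
apply: le_trans (dot_le_enorm _ _) _.
have := gL (x + t *: u) x; rewrite addrAC subrr add0r enormZ (ger0_norm t0).
by move=> /(ler_wpM2r (enorm_ge0 u)) /le_trans; apply; lra.
Qed.

Lemma grad_inequality g x y :
  convex_function [set: convex_lmodType 'rV[R]_n.+1] g ->
  differentiable g x -> g x + dot (grad g x) (y - x) <= g y.
Proof. by move=> cg dg; rewrite -derive_dot//; exact: convex_gradient_le. Qed.

Lemma cocoercivity g (L : R) x y :
  convex_function [set: convex_lmodType 'rV[R]_n.+1] g ->
  (forall z, differentiable g z) -> lipschitz_grad g L ->
  enorm (grad g x - grad g y) ^+ 2 <= L * dot (grad g x - grad g y) (x - y).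
Proof.
move=> cg dg gL; have := lipschitz_grad_ge0 gL.
rewrite le_eqVlt => /predU1P[L0|L0].
  have := gL x y; rewrite -L0 !mul0r => v0.
  suff -> : enorm (grad g x - grad g y) = 0 by rewrite expr0n.
  by apply/eqP; rewrite eq_le v0 enorm_ge0.
(* At the point [b + L^-1 *: (grad g a - grad g b)], the tangent at [a] lies below [g] and the
   quadratic model at [b] above it. The claim is the sum of this bound and its mirror image. *)
have half a b : g a + dot (grad g a) (b - a)
    + L^-1 / 2 * enorm (grad g a - grad g b) ^+ 2 <= g b.
  have := lipschitz_grad_descent b (L^-1 *: (grad g a - grad g b)) dg gL.
  have := grad_inequality (b + L^-1 *: (grad g a - grad g b)) cg (dg a).
  rewrite [X in dot _ (X - a)]addrC -addrA [in X in X <= _ -> _]dotDr !dotZr enormZ exprMn.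
  rewrite normfV (gtr0_norm L0).
  have -> : L / 2 * (L^-1 ^+ 2 * enorm (grad g a - grad g b) ^+ 2) =
     L^-1 / 2 * enorm (grad g a - grad g b) ^+ 2 by field; rewrite gt_eqF.
  have : L^-1 * enorm (grad g a - grad g b) ^+ 2 =
     L^-1 * dot (grad g a) (grad g a - grad g b)
      - L^-1 * dot (grad g b) (grad g a - grad g b).
    by rewrite enorm_sqr_dot dotDl dotNl mulrBr.
  lra.
have := half y x; have := half x y.
have -> : enorm (grad g y - grad g x) = enorm (grad g x - grad g y).
  by rewrite -opprB -scaleN1r enormZ normrN1 mul1r.
have -> : dot (grad g x) (y - x) = - dot (grad g x) (x - y).
  by rewrite -dotNr opprB.
rewrite dotDl dotNl => h1 h2.
rewrite -(ler_pM2l (_ : 0 < L^-1)) ?invr_gt0// mulKf ?gt_eqF//.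
lra.
Qed.

(** Completing the square in cocoercivity puts [v] in the ball of centre [(L / 2) *: z] and radius
    [L / 2 * enorm z]; since [z] vanishes at [k], so does that coordinate of the centre. *)
Lemma partial_variation_orthogonal g (L : R) k x y :
  convex_function [set: convex_lmodType 'rV[R]_n.+1] g ->
  (forall z, differentiable g z) -> lipschitz_grad g L ->
  (x - y) ord0 k = 0 ->
  (partial g k x - partial g k y) ^+ 2 <= L ^+ 2 / 4 * enorm (x - y) ^+ 2.
Proof.
move=> cg dg gL xy0; have := cocoercivity x y cg dg gL.
set v := grad g x - grad g y; set z := x - y => vz.
have vk : v ord0 k = partial g k x - partial g k y by rewrite !mxE.
have zk : z ord0 k = 0 := xy0.
rewrite -vk; clearbody v z.
have -> : v ord0 k = (v - (L / 2) *: z) ord0 k by rewrite !mxE zk mulr0 subr0.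
apply: le_trans (coord_sqr_le_enorm _ _) _.
rewrite enorm_sqr_dot !(dotDl, dotDr, dotNl, dotNr, dotZl, dotZr) (dotC z v).
move: vz; rewrite !enorm_sqr_dot; lra.
Qed.

End Coordinates.

(** * Displacement, decrease and gradient drift over one cycle *)

Section Cycle.
Context {R : realType} {n : nat}.
Context (g : 'rV[R]_n.+1 -> R) (P : 'I_n.+1 -> R) (x : 'rV[R]_n.+1).

(* The point w_{i+1} of the cycle started at x; [increment k] and [drift k] are
   the d_k and a_k of the header. *)
Definition inner (i : nat) : 'rV[R]_n.+1 :=
  foldl (cgd_step g P) x (take i (enum 'I_n.+1)).

Definition increment (k : 'I_n.+1) : R := (P k)^-1 * partial g k (inner k).

Lemma innerS (k : 'I_n.+1) :
  inner k.+1 = inner k - increment k *: unit_vec k.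
Proof.
by rewrite /inner (take_nth k) ?size_enum_ord// nth_ord_enum -cats1 foldl_cat.
Qed.

Lemma inner_last : inner n.+1 = cgd_cycle g P x.
Proof. by rewrite /inner take_oversize// size_enum_ord. Qed.

Lemma inner_coord i (j : 'I_n.+1) : (i <= n.+1)%N ->
  (x - inner i) ord0 j = if (j < i)%N then increment j else 0.
Proof.
elim: i => [_|i IH lt_in]; first by rewrite /inner take0 /= subrr mxE.
have -> : inner i.+1 = inner i - increment (Ordinal lt_in) *:
    unit_vec (Ordinal lt_in).
  exact: innerS (Ordinal lt_in).
rewrite opprB addrCA mxE (IH (ltnW lt_in)) !mxE eqxx /= ltnS [(j <= i)%N]leq_eqVlt.
have [->|ji] := eqVneq j (Ordinal lt_in).
  by rewrite /= eqxx ltnn mulr1 addr0.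
have /negbTE -> : (j : nat) != i by [].
by rewrite mulr0 add0r.
Qed.

Lemma enorm_inner i : (i <= n.+1)%N ->
  enorm (x - inner i) ^+ 2 <= \sum_k increment k ^+ 2.
Proof.
move=> ilen; rewrite enorm_sqr; apply: ler_sum => k _.
by rewrite inner_coord//; case: ifP => // _; rewrite expr0n sqr_ge0.
Qed.

(** The one-coordinate descent bounds telescope, with [partial g k (inner k) = P k * increment
    k]. *)
Lemma cycle_decrease (l : R) :
  (forall y, differentiable g y) ->
  (forall k y, differentiable (partial g k) y) ->
  (forall k, 0 < P k) -> (forall k y, `|hess g k k y| <= l) ->
  \sum_k increment k ^+ 2 * (2 * P k - l) <= 2 * (g x - g (cgd_cycle g P x)).
Proof.
move=> dg dpg P0 hl.
have -> : g x - g (cgd_cycle g P x) = \sum_(k < n.+1) (g (inner k) - g (inner k.+1)).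
  rewrite -(big_mkord xpredT (fun i => g (inner i) - g (inner i.+1))).
  rewrite (telescope_sumr_eq (fun i => - g (inner i)))// ?inner_last ?opprK.
    by rewrite addrC /inner take0.
  by move=> i _; rewrite opprK addrC.
rewrite mulr_sumr; apply: ler_sum => k _.
have := coordinate_descent (inner k) (- increment k) dg (dpg k) (hl k).
rewrite scaleNr -innerS sqrrN.
have -> : partial g k (inner k) = P k * increment k.
  by rewrite /increment mulVKf ?gt_eqF.
nra.
Qed.

Definition drift (k : 'I_n.+1) : R := partial g k x - partial g k (inner k).

Lemma sum_drift_lipschitz (L : R) :
  convex_function [set: convex_lmodType 'rV[R]_n.+1] g ->
  (forall y, differentiable g y) -> lipschitz_grad g L ->
  \sum_k drift k ^+ 2 <= n%:R * (L ^+ 2 / 4) * \sum_k increment k ^+ 2.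
Proof.
move=> cg dg gL; rewrite big_ord_recl {1}/drift /inner take0 subrr expr0n add0r.
apply: (@le_trans _ _ (\sum_(k < n) L ^+ 2 / 4 * \sum_k increment k ^+ 2)); last first.
  by rewrite sumr_const card_ord mulr_natl mulrnAl.
apply: ler_sum => i _; set k := lift ord0 i.
have kn : (k <= n.+1)%N by exact: ltnW.
apply: le_trans (partial_variation_orthogonal cg dg gL _) _.
  by rewrite inner_coord// ltnn.
by apply: ler_wpM2l (enorm_inner kn); rewrite divr_ge0// sqr_ge0.
Qed.

Lemma sum_drift_hess (Lij : 'M[R]_n.+1) :
  (forall k y, differentiable (partial g k) y) ->
  (forall i j y, `|hess g i j y| <= Lij i j) ->
  (forall i j, Lij i j <= Num.sqrt (Lij i i) * Num.sqrt (Lij j j)) ->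
  \sum_k drift k ^+ 2 <=
  (\sum_(k < n.+1) Lij k k * \sum_(j < n.+1 | (j < k)%N) Lij j j)
    * \sum_k increment k ^+ 2.
Proof.
move=> dpg hL sL.
have L0 i : 0 <= Lij i i by apply: le_trans (hL i i x).
rewrite mulr_suml; apply: ler_sum => k _.
have drift_le : `|drift k| <=
    \sum_(j < n.+1 | (j < k)%N)
      Num.sqrt (Lij k k) * (Num.sqrt (Lij j j) * `|increment j|).
  (* For fixed [k], induction on the number [i] of coordinate moves made, each costing one mixed
     second derivative. *)
  suff H i : (i <= n.+1)%N -> `|partial g k x - partial g k (inner i)| <=
      \sum_(j < n.+1 | (j < i)%N)
      Num.sqrt (Lij k k) * (Num.sqrt (Lij j j) * `|increment j|).
    exact/H/ltnW.
  elim: i => [_|i IH lt_in].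
    by rewrite /inner take0 /= subrr normr0 big_pred0.
  rewrite (bigD1 (Ordinal lt_in))//= addrC.
  rewrite (eq_bigl (fun j : 'I_n.+1 => (j < i)%N)); last first.
    by move=> j; rewrite ltnS ltn_neqAle andbC.
  rewrite -(subrKA (partial g k (inner i))).
  apply: le_trans (ler_normD _ _) (lerD (IH (ltnW lt_in)) _).
  have := partial_variation (inner i) (- increment (Ordinal lt_in)) (dpg k)
    (hL (Ordinal lt_in) k).
  rewrite scaleNr -(innerS (Ordinal lt_in)) normrN distrC => /le_trans; apply.
  rewrite mulrCA mulrC mulrA ler_wpM2r// mulrC; exact: sL.
have := lerXn2r 2 _ _ drift_le; rewrite !nnegrE normr_ge0 (le_trans _ drift_le)//.
move=> /(_ isT isT); rewrite real_normK ?num_real// -mulr_sumr exprMn sqr_sqrtr//.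
move=> /le_trans; apply; rewrite -mulrA ler_wpM2l//.
apply: le_trans (cauchy_schwarz_sum _ _ _) _.
rewrite (eq_bigr (fun j => Lij j j)) => [|j _];
  last by rewrite sqr_sqrtr.
rewrite ler_wpM2l ?sumr_ge0// [leRHS](bigID (fun j : 'I_n.+1 => (j < k)%N))/=.
rewrite (eq_bigr (fun j => increment j ^+ 2)) => [|j _];
  last by rewrite real_normK ?num_real.
by rewrite lerDl sumr_ge0// => j _; exact: sqr_ge0.
Qed.

End Cycle.

(** * Spectral norm and rows of the Hessian *)

Section Spectral.
Context {R : realType} {n : nat}.
Implicit Types (A : 'M[R]_n.+1) (g : 'rV[R]_n.+1 -> R).

Lemma spectral_norm_le_frobenius A :
  spectral_norm A ^+ 2 <= \sum_k \sum_j A k j ^+ 2.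
Proof.
set F := \sum_k _.
have F0 : 0 <= F by do 2 (apply: sumr_ge0 => ? _); exact: sqr_ge0.
have bound v : enorm v = 1 -> enorm (v *m A^T) <= Num.sqrt F.
  move=> v1; rewrite -(@ler_pXn2r _ 2)// ?nnegrE ?enorm_ge0 ?sqrtr_ge0//.
  rewrite enorm_sqr (sqr_sqrtr F0); apply: ler_sum => k _.
  rewrite -[leRHS]mulr1 -(expr1n _ 2) -v1 enorm_sqr.
  rewrite mxE (eq_bigr (fun j => A k j * v ord0 j)) => [|j _];
  last by rewrite mxE mulrC.
  exact: cauchy_schwarz_sum.
set S := [set enorm (v *m A^T) | v in [set v | enorm v = 1]].
have Sub : ubound S (Num.sqrt F) by move=> _ [v v1 <-]; exact: bound.
(* This element makes the set nonempty and its supremum nonnegative, as squaring requires. *)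
have Se : S (enorm (unit_vec ord0 *m A^T)).
  by exists (unit_vec ord0) => //; exact: enorm_unit_vec.
have S0 : S !=set0 by eexists; exact: Se.
rewrite -(sqr_sqrtr F0) lerXn2r ?nnegrE ?sqrtr_ge0//.
  apply: le_trans (enorm_ge0 _) (ub_le_sup _ Se).
  by exists (Num.sqrt F).
exact: ge_sup.
Qed.

(* The row is paired with itself, N = D_{e_k} (grad g), so that only the scalar
   function z |-> <grad g(z), N> has to be differentiated. *)
Lemma hess_row_le g (L : R) k x : lipschitz_grad g L ->
  differentiable (grad g) x -> \sum_j hess g k j x ^+ 2 <= L ^+ 2.
Proof.
move=> gL dg; set N : 'rV[R]_n.+1 := \row_j hess g k j x.
have -> : \sum_j hess g k j x ^+ 2 = enorm N ^+ 2.
  by rewrite enorm_sqr; apply: eq_bigr => j _; rewrite mxE.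
have dp j : derivable (N ord0 j \*: partial g j) x (unit_vec k).
  by apply: derivableZ; exact/diff_derivable/differentiable_partial.
pose f : 'rV[R]_n.+1 -> R := \sum_j (N ord0 j \*: partial g j).
have fE z : f z = dot (grad g z) N.
  rewrite /f fct_sumE; apply: eq_bigr => j _.
  by rewrite [(grad g z) _ _]mxE mulrC.
have Df : 'D_(unit_vec k) f x = enorm N ^+ 2.
  rewrite derive_sum// enorm_sqr; apply: eq_bigr => j _.
  rewrite deriveZ; last exact/diff_derivable/differentiable_partial.
  by rewrite mxE expr2.
have : enorm N ^+ 2 <= L * enorm N.
  rewrite -Df; apply: derive_le => [|h h0 _]; first exact: derivable_sum.
  rewrite !fE -dotNl -dotDl; apply: le_trans (dot_le_enorm _ _) _.
  rewrite mulrA ler_wpM2r ?enorm_ge0//; apply: le_trans (gL _ _) _.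
  by rewrite addrK enormZ enorm_unit_vec mulr1 gtr0_norm// mulrC.
have := lipschitz_grad_ge0 gL; have := enorm_ge0 N; nra.
Qed.

Lemma lower_hess_sqr_le g xi k j :
  lower_hess g xi k j ^+ 2 <= hess g k j (xi k) ^+ 2.
Proof. by rewrite mxE; case: ifP => // _; rewrite expr0n sqr_ge0. Qed.

End Spectral.

(** * From one cycle to the rate *)

Section Rate.
Context {R : realType} {n : nat}.
Implicit Types (P : 'I_n.+1 -> R).

Lemma le_maxc P k : P k <= maxc P.
Proof. exact: le_bigmax. Qed.

Lemma minc_le P k : minc P <= P k.
Proof. exact: bigmin_le. Qed.

Lemma le_minc P (a : R) : (forall k, a <= P k) -> a <= minc P.
Proof. by move=> aP; apply: le_bigmin. Qed.

Lemma minc_gt0 P : (forall k, 0 < P k) -> 0 < minc P.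
Proof. by move=> P0; apply: lt_bigmin. Qed.

(** Common to both values of the minimum, which differ only in the choice of [l], [m] and [M]. *)
Lemma grad_le_decrease (g : 'rV[R]_n.+1 -> R) P x (l m M : R) :
  (forall y, differentiable g y) ->
  (forall k y, differentiable (partial g k) y) ->
  (forall k, 0 < P k) -> (forall k y, `|hess g k k y| <= l) ->
  l <= minc P -> 0 <= m -> l ^+ 2 + 2 * m <= M ->
  \sum_k drift g P x k ^+ 2 <= m * \sum_k increment g P x k ^+ 2 ->
  enorm (grad g x) ^+ 2 <=
    2 * (maxc P + M / minc P) * (g x - g (cgd_cycle g P x)).
Proof.
move=> dg dpg P0 hl lP m0 lmM drift_le.
have l0 : 0 <= l := le_trans (normr_ge0 _) (hl ord0 x).
have [t t0 young] := young_constant (maxc P) (minc_gt0 P0) l0 lP m0 lmM.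
have C0 : 0 <= maxc P + M / minc P.
  apply: addr_ge0; first exact: le_trans (ltW (P0 ord0)) (le_maxc _ _).
  apply: divr_ge0; last exact/ltW/minc_gt0.
  by apply: le_trans lmM; rewrite addr_ge0 ?sqr_ge0 ?mulr_ge0.
have := ler_wpM2l C0 (cycle_decrease x dg dpg P0 hl).
rewrite mulrCA mulrA => /(le_trans _); apply.
have ti0 : 0 < t^-1 by rewrite invr_gt0.
apply: (@le_trans _ _ (\sum_k ((1 + t) * (P k * increment g P x k) ^+ 2
    + (1 + t^-1) * drift g P x k ^+ 2))).
  rewrite enorm_sqr; apply: ler_sum => k _; rewrite mxE.
  have -> : partial g k x = P k * increment g P x k + drift g P x k.
    by rewrite /increment mulVKf ?gt_eqF// /drift addrC subrK.
  set a := _ * _; set b := drift _ _ _ _; rewrite -subr_ge0.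
  have -> : (1 + t) * a ^+ 2 + (1 + t^-1) * b ^+ 2 - (a + b) ^+ 2 =
      t^-1 * (t * a - b) ^+ 2 by field; rewrite gt_eqF.
  by rewrite mulr_ge0 ?sqr_ge0// ltW.
rewrite big_split -!mulr_sumr.
have t1 : 0 <= 1 + t^-1 by rewrite addr_ge0// ltW.
apply: (le_trans (lerD (lexx _) (ler_wpM2l t1 drift_le))).
rewrite !mulr_sumr -big_split; apply: ler_sum => k _ /=.
have := young _ (minc_le P k) (le_maxc P k).
move=> /(ler_wpM2l (sqr_ge0 (increment g P x k))); lra.
Qed.

(** Monotonicity keeps the iterates in the initial level set, so [radius0] bounds their distance to
    [xstar]; convexity then bounds each gap by gradient norm times radius. *)
Lemma cgd_rate (g : 'rV[R]_n.+1 -> R) P x0 xstar (C : R) r :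
  convex_function [set: convex_lmodType 'rV[R]_n.+1] g ->
  (forall y, differentiable g y) ->
  has_ubound (level_dists g x0) -> minimizers g xstar -> 0 <= C ->
  (forall x, g (cgd_cycle g P x) <= g x) ->
  (forall x, enorm (grad g x) ^+ 2 <= C * (g x - g (cgd_cycle g P x))) ->
  (0 < r)%N ->
  g (cgd g P x0 r) - g xstar <= C * (radius0 g x0 ^+ 2 / r%:R).
Proof.
move=> cg dg ubd xmin C0 mono gC r0; pose y i := cgd g P x0 i.
have y_le i : g (y i) <= g x0.
  by elim: i => [|i IH]; [exact: lexx|exact: le_trans (mono _) IH].
have dist_le i : enorm (y i - xstar) <= radius0 g x0.
  by apply: ub_le_sup => //; exists (y i), xstar; split.
rewrite mulrA ler_pdivlMr ?ltr0n// mulrC.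
apply: (sqr_recursion_bound (D := fun i => g (y i) - g xstar)).
- by rewrite mulr_ge0 ?sqr_ge0.
- by move=> i; rewrite subr_ge0; exact: xmin.
move=> i.
have gap_le : g (y i) - g xstar <= enorm (grad g (y i)) * radius0 g x0.
  have := grad_inequality xstar cg (dg (y i)).
  have := dot_le_enorm (grad g (y i)) (- (xstar - y i)).
  rewrite dotNr opprB.
  have := ler_wpM2l (enorm_ge0 (grad g (y i))) (dist_le i); lra.
have := lerXn2r 2 _ _ gap_le.
rewrite !nnegrE subr_ge0 xmin (le_trans _ gap_le) ?subr_ge0 ?xmin//.
move=> /(_ isT isT) /le_trans; apply; rewrite exprMn.
have := ler_wpM2r (sqr_ge0 (radius0 g x0)) (gC (y i)).
have -> : g (y i) - g xstar - (g (y i.+1) - g xstar) = g (y i) - g (y i.+1) by ring.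
by move=> /le_trans; apply; rewrite mulrAC.
Qed.

End Rate.

(** * Squares of sums and their strictly triangular part *)

Lemma sqr_sum_ord (R : comPzRingType) n (a : 'I_n -> R) :
  (\sum_k a k) ^+ 2 =
  \sum_k a k ^+ 2 + 2 * \sum_(k < n) a k * \sum_(j < n | (j < k)%N) a j.
Proof.
rewrite expr2 big_distrlr /=.
pose U := \sum_(k < n) \sum_(j < n | (k < j)%N) a k * a j.
have UE : U = \sum_(k < n) a k * \sum_(j < n | (j < k)%N) a j.
  rewrite /U (exchange_big_dep xpredT)//=; apply: eq_bigr => k _.
  by rewrite mulr_sumr; apply: eq_bigr => j _; rewrite mulrC.
rewrite mulr_natl mulr2n -{1}UE /U -!big_split /=; apply: eq_bigr => k _.
rewrite (bigD1 k)//= expr2 (bigID (fun j : 'I_n => (k < j)%N))/= mulr_sumr.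
by congr (_ + (_ + _)); apply: eq_bigl => j; rewrite -val_eqE /=; case: ltngtP.
Qed.

(** The square of the largest term is at most the sum of squares. *)
Lemma max_sqr_add_cross_le (R : realType) n (a : 'I_n.+1 -> R) :
  (forall k, 0 <= a k) ->
  maxc a ^+ 2 + 2 * (\sum_(k < n.+1) a k * \sum_(j < n.+1 | (j < k)%N) a j)
  <= (\sum_k a k) ^+ 2.
Proof.
move=> a0; rewrite sqr_sum_ord lerD2r.
have s0 : 0 <= \sum_k a k ^+ 2 by apply: sumr_ge0 => k _; exact: sqr_ge0.
rewrite -[leRHS]sqr_sqrtr// lerXn2r ?nnegrE ?sqrtr_ge0//.
  exact: le_trans (a0 ord0) (le_maxc _ _).
have le_s k : a k <= Num.sqrt (\sum_k a k ^+ 2).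
  rewrite -(ger0_norm (a0 k)) -sqrtr_sqr ler_wsqrtr// (bigD1 k)//= lerDl.
  by apply: sumr_ge0 => j _; exact: sqr_ge0.
by apply: bigmax_le.
Qed.

Unset Implicit Arguments.

Theorem corollary4p1 (R : realType) (n : nat) (g : 'rV[R]_n.+1 -> R)
    (L : R) (Lij : 'M[R]_n.+1) (P : 'I_n.+1 -> R) (x0 : 'rV[R]_n.+1)
    (g_convex : convex_function [set: convex_lmodType 'rV[R]_n.+1] g)
    (g_diff2 : twice_differentiable g)
    (g_lip : lipschitz_grad g L)
    (hess_le : forall i j x, `|hess g i j x| <= Lij i j)
    (Lij_le : forall i j,
       Lij i j <= Num.sqrt (Lij i i) * Num.sqrt (Lij j j))
    (P_gt0 : forall k, 0 < P k)
    (P_ge : forall k, maxc (fun i => Lij i i) <= P k)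
    (min_ex : minimizers g !=set0)
    (radius_fin : has_ubound (level_dists g x0)) :
  (forall xi : 'I_n.+1 -> 'rV[R]_n.+1,
     spectral_norm (lower_hess g xi) ^+ 2
       <= Num.min (n.+1%:R * L ^+ 2) ((\sum_k Lij k k) ^+ 2)) /\
  (forall xstar, minimizers g xstar -> forall r : nat, (1 <= r)%N ->
     g (cgd g P x0 r) - g xstar
       <= 2 * (maxc P
               + Num.min (n.+1%:R * L ^+ 2) ((\sum_k Lij k k) ^+ 2) / minc P)
            * (radius0 g x0 ^+ 2 / r%:R)).
Proof.
have [dg dgrad] := g_diff2.
have dpg k y : differentiable (partial g k) y by exact: differentiable_partial.
have Lk0 k : 0 <= Lij k k by apply: le_trans (hess_le k k x0).
have L0 := lipschitz_grad_ge0 g_lip.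
split=> [xi|xstar xmin r r0].
  rewrite le_min; apply/andP; split; apply: le_trans (spectral_norm_le_frobenius _) _.
    apply: (@le_trans _ _ (\sum_(k < n.+1) L ^+ 2)); last first.
      by rewrite sumr_const card_ord mulr_natl.
    apply: ler_sum => k _; apply: le_trans (hess_row_le k g_lip (dgrad (xi k))).
    by apply: ler_sum => j _; exact: lower_hess_sqr_le.
  rewrite expr2 big_distrlr /=; apply: ler_sum => k _; apply: ler_sum => j _.
  apply: le_trans (lower_hess_sqr_le _ _ _ _) _.
  rewrite -(sqr_sqrtr (Lk0 k)) -(sqr_sqrtr (Lk0 j)) -exprMn.
  rewrite -(@real_normK _ (hess _ _ _ _)) ?num_real// lerXn2r ?nnegrE ?mulr_ge0 ?sqrtr_ge0//.
  exact: le_trans (hess_le _ _ _) (Lij_le _ _).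
set M := Num.min _ _.
have M0 : 0 <= M by rewrite le_min mulr_ge0 ?sqr_ge0.
have C0 : 0 <= 2 * (maxc P + M / minc P).
  rewrite mulr_ge0// addr_ge0 ?divr_ge0 ?(ltW (minc_gt0 P_gt0))//.
  exact: le_trans (ltW (P_gt0 ord0)) (le_maxc _ _).
have hess_max k y : `|hess g k k y| <= maxc (fun i => Lij i i).
  by apply: le_trans (hess_le k k y) (le_maxc (fun i => Lij i i) k).
have max_min : maxc (fun i => Lij i i) <= minc P by exact: le_minc.
apply: cgd_rate => // x.
  have := cycle_decrease x dg dpg P_gt0 hess_max.
  suff : 0 <= \sum_k increment g P x k ^+ 2 * (2 * P k - maxc (fun i => Lij i i)) by lra.
  apply: sumr_ge0 => k _; rewrite mulr_ge0 ?sqr_ge0//.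
  by have := P_ge k; have := P_gt0 k; lra.
rewrite /M minEle; case: ifP => _.
  (* [l] must be at most [L] for the constant and at most [minc P] for Young's inequality, hence the
     minimum. *)
  apply: (@grad_le_decrease _ _ _ _ _ (Num.min L (maxc (fun i => Lij i i)))
    (n%:R * (L ^+ 2 / 4))) => //.
  - move=> k y; rewrite le_min hess_max andbT.
    rewrite -(@ler_pXn2r _ 2)// ?nnegrE// real_normK ?num_real//.
    apply: le_trans (hess_row_le k g_lip (dgrad y)).
    by rewrite (bigD1 k)//= lerDl sumr_ge0// => j _; exact: sqr_ge0.
  - by rewrite ge_min max_min orbT.
  - by rewrite mulr_ge0 ?divr_ge0 ?sqr_ge0.
  (* With K = n + 1, [L ^+ 2 + n * L ^+ 2 / 2] is at most [K * L ^+ 2]. *)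
  - have : Num.min L (maxc (fun i => Lij i i)) ^+ 2 <= L ^+ 2.
      rewrite lerXn2r ?nnegrE ?ge_min ?lexx// le_min L0.
      exact: le_trans (Lk0 ord0) (le_maxc (fun i => Lij i i) _).
    have : 0 <= n%:R * L ^+ 2 by rewrite mulr_ge0 ?sqr_ge0.
    rewrite -natr1; lra.
  - exact: sum_drift_lipschitz.
apply: (@grad_le_decrease _ _ _ _ _ (maxc (fun i => Lij i i))
  (\sum_(k < n.+1) Lij k k * \sum_(j < n.+1 | (j < k)%N) Lij j j)) => //.
- by apply: sumr_ge0 => k _; rewrite mulr_ge0 ?sumr_ge0.
- exact: max_sqr_add_cross_le.
- exact: sum_drift_hess.
Qed.
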